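(* Let $\Omega\subset\mathbb{R}^n$ be a bounded domain of class $C^2$ and let $0<a\le A$. For $\alpha>0$ let $\lambda_\alpha^\pm$ be the principal eigenvalues defined in the context, and let $u_\alpha^+>0$ and $u_\alpha^-<0$ on $\overline\Omega$ be viscosity solutions of $$\mathcal{M}_{a,A}^+(D^2u_\alpha^\pm)+\lambda_\alpha^\pm u_\alpha^\pm=0\ \text{ in }\Omega,\qquad \frac{\partial u_\alpha^\pm}{\partial\overrightarrow{n}}=\alpha u_\alpha^\pm\ \text{ on }\partial\Omega,$$ normalized so that $\|u_\alpha^\pm\|_\infty=1$. Then for any compact set $K\subset\Omega$, $$\|u_\alpha^{+}\|_{L^\infty(K)}\to0\quad\text{and}\quad\|u_\alpha^{-}\|_{L^\infty(K)}\to0\qquad\text{as }\alpha\to+\infty.$$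
   Context: $S(n)$ is the space of real symmetric $n\times n$ matrices with the usual ordering. For $M\in S(n)$, $\mathcal{M}_{a,A}^+(M)=\sup\{\mathrm{tr}(\sigma M): \sigma\in S(n),\ aI\le\sigma\le AI\}$. $\overrightarrow{n}(x)$ is the exterior unit normal to $\partial\Omega$ at $x$. $\|\cdot\|_\infty$ is the sup norm on $\overline\Omega$. Viscosity solutions. Let $\alpha>0$, $\lambda\in\mathbb{R}$. A function $u\in USC(\overline\Omega)$ (upper semicontinuous) is a viscosity subsolution of $\mathcal{M}_{a,A}^+(D^2u)+\lambda u=0$ in $\Omega$, $\frac{\partial u}{\partial\overrightarrow{n}}=\alpha u$ on $\partial\Omega$, if whenever $\varphi\in C^2(\overline\Omega)$ and $u-\varphi$ has a local maximum (relative to $\overline\Omega$) at $x_0\in\overline\Omega$: (i) if $x_0\in\Omega$, then $\mathcal{M}_{a,A}^+(D^2\varphi(x_0))+\lambda u(x_0)\ge 0$; (ii) if $x_0\in\partial\Omega$, then $\min\{-(\mathcal{M}_{a,A}^+(D^2\varphi(x_0))+\lambda u(x_0)),\ \frac{\partial\varphi}{\partial\overrightarrow{n}}(x_0)-\alpha u(x_0)\}\le 0$. A function $u\in LSC(\overline\Omega)$ (lower semicontinuous) is a viscosity supersolution if whenever $\varphi\in C^2(\overline\Omega)$ and $u-\varphi$ has a local minimum at $x_0$: (i) if $x_0\in\Omega$, then $\mathcal{M}_{a,A}^+(D^2\varphi(x_0))+\lambda u(x_0)\le 0$; (ii) if $x_0\in\partial\Omega$, then $\max\{-(\mathcal{M}_{a,A}^+(D^2\varphi(x_0))+\lambda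 u(x_0)),\ \frac{\partial\varphi}{\partial\overrightarrow{n}}(x_0)-\alpha u(x_0)\}\ge 0$. A viscosity solution is a continuous function on $\overline\Omega$ that is both a subsolution and a supersolution. Principal eigenvalues: $\lambda_\alpha^+:=\sup\{\lambda\in\mathbb{R}:$ there exists $v>0$ on $\overline\Omega$, bounded viscosity supersolution of $\mathcal{M}_{a,A}^+(D^2v)+\lambda v=0$ in $\Omega$, $\frac{\partial v}{\partial\overrightarrow{n}}=\alpha v$ on $\partial\Omega\}$; $\lambda_\alpha^-:=\sup\{\lambda\in\mathbb{R}:$ there exists $v<0$ on $\overline\Omega$, bounded viscosity subsolution of $\mathcal{M}_{a,A}^+(D^2v)+\lambda v=0$ in $\Omega$, $\frac{\partial v}{\partial\overrightarrow{n}}=\alpha v$ on $\partial\Omega\}$. *)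

(* Defs.v *)
From HB Require Import structures.
From mathcomp Require Import all_boot all_order all_algebra.
From mathcomp Require Import all_classical all_reals all_analysis.

Set Implicit Arguments.
Unset Strict Implicit.
Unset Printing Implicit Defensive.

Import Order.TTheory GRing.Theory Num.Theory.
Import numFieldNormedType.Exports.

Local Open Scope classical_set_scope.
Local Open Scope ring_scope.

(* R^m is 'rV[R]_m. Its library norm is the max norm: it is used only for      *)
(* topological notions; Euclidean lengths go through dotv.                     *)

Section EuclideanSpace.
Context {R : realType} {m : nat}.
Implicit Types (u v : 'rV[R]_m) (M S T : 'M[R]_m).

Definition dotv u v : R := \sum_(i < m) u 0 i * v 0 i.

Definition normalize v : 'rV[R]_m := (Num.sqrt (dotv v v))^-1 *: v.

Definition symmetric_mx M : Prop := M^T = M.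

Definition psd_mx M : Prop := forall v, 0 <= (v *m M *m v^T) 0 0.

Definition le_mx S T : Prop := psd_mx (T - S).

Definition pucci (a A : R) M : R :=
  sup [set \tr (sigma *m M) | sigma in
    [set sigma | [/\ symmetric_mx sigma, le_mx a%:M sigma & le_mx sigma A%:M]]].

(* For A open: f is in C^2(closure A), i.e. f is C^2 in A and f and its        *)
(* partial derivatives up to order 2 extend continuously to closure A; G and H *)
(* are the extended gradient and Hessian (unique on closure A).                *)
Definition C2_closure (A : set 'rV[R]_m) (f : 'rV[R]_m -> R)
    (G : 'rV[R]_m -> 'rV[R]_m) (H : 'rV[R]_m -> 'M[R]_m) : Prop :=
  [/\ {within closure A, continuous f},
      {within closure A, continuous G},
      {within closure A, continuous H},
      (forall x i, A x -> is_derive x (delta_mx 0 i) f (G x 0 i)) &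
      (forall x i j, A x ->
         is_derive x (delta_mx 0 j) (fun y => G y 0 i) (H x i j))].

(* lower_semicontinuous is about functions on a whole space, hence subspace A  *)
Definition LSC (A : set 'rV[R]_m) (u : 'rV[R]_m -> R) : Prop :=
  lower_semicontinuous (fun x : subspace A => (u x)%:E).

Definition USC (A : set 'rV[R]_m) (u : 'rV[R]_m -> R) : Prop :=
  LSC A (fun x => - u x).

Definition sup_norm (A : set 'rV[R]_m) (u : 'rV[R]_m -> R) : R :=
  sup [set `|u x| | x in A].

Definition local_max_on (A : set 'rV[R]_m) (f : 'rV[R]_m -> R)
    (x : 'rV[R]_m) : Prop :=
  \forall y \near x, A y -> f y <= f x.

Definition local_min_on (A : set 'rV[R]_m) (f : 'rV[R]_m -> R)
    (x : 'rV[R]_m) : Prop :=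
  \forall y \near x, A y -> f x <= f y.

Definition boundary (A : set 'rV[R]_m) : set 'rV[R]_m :=
  closure A `\` interior A.

End EuclideanSpace.

Section Domains.
Context {R : realType} {n : nat}.
Local Notation V := 'rV[R]_n.+1.
Implicit Types (Omega : set V) (x : V).

(* s *: (y_i - gamma(y_1, .., y_{i-1}, y_{i+1}, ..)), with the sign s = (-1)^b *)
Definition graph_fun (i : 'I_n.+1) (b : bool) (gamma : 'rV[R]_n -> R)
  (y : V) : R := (-1) ^+ b * (y 0 i - gamma (col' i y)).

(* Near x, up to relabeling and reorienting the coordinate axes, Omega is the  *)
(* set of points lying on one side of the graph of the C^2 function gamma; it  *)
(* is where graph_fun i b gamma is negative.                                   *)
Definition C2_chart Omega x (i : 'I_n.+1) (b : bool)
    (gamma : 'rV[R]_n -> R) : Prop :=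
  (exists G H, C2_closure setT gamma G H) /\
  \forall y \near x, Omega y <-> graph_fun i b gamma y < 0.

Definition C2_domain Omega : Prop :=
  [/\ open Omega, connected Omega, Omega !=set0 &
      forall x, boundary Omega x -> exists i b gamma, C2_chart Omega x i b gamma].

Definition grad (f : V -> R) x : V := \row_j 'D_(delta_mx 0 j) f x.

Definition is_exterior_normal Omega x (nu : V) : Prop :=
  exists i b gamma, C2_chart Omega x i b gamma /\
    nu = normalize (grad (graph_fun i b gamma) x).

(* At a boundary point of a C^2 domain the exterior unit normal exists and is  *)
(* the same for all charts.                                                    *)
Definition exterior_normal Omega x : V := get (is_exterior_normal Omega x).

End Domains.

(* The problem M^+_{a,A}(D^2 u) + lambda u = 0 in Omega,                       *)
(* du/dn = alpha u on its boundary.                                            *)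
Section RobinProblem.
Context {R : realType} {n : nat}.
Local Notation V := 'rV[R]_n.+1.
Variables (Omega : set V) (a A : R).
Implicit Types (lambda alpha : R) (u : V -> R).

Definition viscosity_subsolution lambda alpha u : Prop :=
  USC (closure Omega) u /\
  forall phi G H, C2_closure Omega phi G H ->
  forall x, closure Omega x ->
    local_max_on (closure Omega) (fun y => u y - phi y) x ->
    (Omega x -> 0 <= pucci a A (H x) + lambda * u x) /\
    (boundary Omega x ->
       Num.min (- (pucci a A (H x) + lambda * u x))
               (dotv (G x) (exterior_normal Omega x) - alpha * u x) <= 0).

Definition viscosity_supersolution lambda alpha u : Prop :=
  LSC (closure Omega) u /\
  forall phi G H, C2_closure Omega phi G H ->
  forall x, closure Omega x ->
    local_min_on (closure Omega) (fun y => u y - phi y) x ->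
    (Omega x -> pucci a A (H x) + lambda * u x <= 0) /\
    (boundary Omega x ->
       0 <= Num.max (- (pucci a A (H x) + lambda * u x))
                    (dotv (G x) (exterior_normal Omega x) - alpha * u x)).

Definition viscosity_solution lambda alpha u : Prop :=
  [/\ {within closure Omega, continuous u},
      viscosity_subsolution lambda alpha u &
      viscosity_supersolution lambda alpha u].

Definition positive_on_closure u : Prop :=
  forall x, closure Omega x -> 0 < u x.

Definition negative_on_closure u : Prop :=
  forall x, closure Omega x -> u x < 0.

(* sup is the supremum in R, with value 0 on sets without one; the two sets    *)
(* below are nonempty and bounded above for Omega bounded of class C^2 and     *)
(* alpha > 0.                                                                  *)
Definition lambda_plus alpha : R :=
  sup [set lambda | exists v : V -> R,
    [/\ positive_on_closure v, [bounded v x | x in closure Omega] &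
        viscosity_supersolution lambda alpha v]].

Definition lambda_minus alpha : R :=
  sup [set lambda | exists v : V -> R,
    [/\ negative_on_closure v, [bounded v x | x in closure Omega] &
        viscosity_subsolution lambda alpha v]].

End RobinProblem.

(* Main.v *)
(* The eigenvalues go to -oo: sliding the barrier m * expR (k * x_0) until it  *)
(* touches v = u_alpha on the closure of Omega (from below if v > 0, from      *)
(* above if v < 0), the boundary condition cannot hold at the touching point   *)
(* when k < alpha, because the normal derivative of the barrier is at most     *)
(* k * |v| there. So the equation holds, and it forces lambda <= - a * k ^+ 2; *)
(* take k = alpha / 2. In the interior, testing v with the paraboloid          *)
(* +- |x - z|^2 / d^2, where the ball of radius d around z lies in Omega,      *)
(* gives |lambda| * |v z| <= C / d ^+ 2 since |v| <= 1.                        *)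

Require Import Defs.
From mathcomp Require Import all_boot all_order all_algebra.
From mathcomp Require Import all_classical all_reals all_analysis.
From mathcomp Require Import ring lra.

Import Order.TTheory GRing.Theory Num.Theory.
Import numFieldNormedType.Exports.

Local Open Scope classical_set_scope.
Local Open Scope ring_scope.

(** Two estimates on a signed solution v with |v| at most 1 are played against each other. Global:
    the Robin condition makes v grow towards the boundary at rate alpha, which an exponential
    barrier of rate alpha / 2 converts into lambda <= - a * alpha^2 / 4
    ([supersolution_eigenvalue_le] for v > 0, [subsolution_eigenvalue_le] for v < 0). Interior: a
    paraboloid centred at z, of height 1 at distance d, gives |lambda| * |v z| * d^2 <= C with C
    independent of alpha ([subsolution_interior_bound] for v > 0, [supersolution_interior_bound] for
    v < 0). Each sign thus uses one viscosity inequality for the eigenvalue and the opposite one for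
    the interior bound.

    Together, |v z| <= 4 * C / (a * alpha^2 * d^2). As d can be taken locally constant in z,
    compactness of K makes the decay uniform ([sup_norm_cvg0]). *)

Section PucciDiagonal.

(** * The Pucci operator on diagonal matrices *)

Context {R : realType} {m : nat}.
Implicit Types (a A : R) (S T : 'M[R]_m) (d : 'rV[R]_m).

Lemma le_mx_diag S T (i : 'I_m) : le_mx S T -> S i i <= T i i.
Proof.
move=> /(_ (delta_mx 0 i)); rewrite -rowE trmx_delta -colE !mxE subr_ge0.
exact.
Qed.

(** Both test functions have diagonal Hessians, so only the diagonal entries of sigma matter, and
    these lie in [a, A]. *)
Lemma mxtrace_mul_diag S d : \tr (S *m diag_mx d) = \sum_i S i i * d 0 i.
Proof. by rewrite mul_mx_diag; apply: eq_bigr => i _; rewrite mxE. Qed.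

Lemma diag_bounds a A (sigma : 'M[R]_m) (i : 'I_m) :
  le_mx a%:M sigma -> le_mx sigma A%:M -> a <= sigma i i <= A.
Proof.
by move=> /(le_mx_diag _ _ i) + /(le_mx_diag _ _ i); rewrite !mxE eqxx !mulr1n => -> ->.
Qed.

Lemma le_mx_scalar a A : a <= A -> le_mx a%:M (A%:M : 'M[R]_m).
Proof.
move=> aA v; rewrite -raddfB /= -mulmxA mul_scalar_mx -scalemxAr mxE.
apply: mulr_ge0; first by rewrite subr_ge0.
by rewrite mxE; apply: sumr_ge0 => i _; rewrite !mxE -expr2 sqr_ge0.
Qed.

Lemma pucci_diag_ge a A d : a <= A ->
  a * \sum_i d 0 i <= pucci a A (diag_mx d).
Proof.
move=> aA; apply: ub_le_sup.
  (* The real [sup] dominates its set only if the set is bounded above; this bound uses |sigma i i|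
     <= |a| + |A|. *)
  exists (\sum_i (`|a| + `|A|) * `|d 0 i|) => _ [sigma [_ aS SA] <-].
  rewrite mxtrace_mul_diag; apply: ler_sum => i _.
  apply: (le_trans (ler_norm _)); rewrite normrM ler_wpM2r //.
  by have /andP[ai iA] := diag_bounds a A sigma i aS SA; rewrite ler_norml;
  have := ler_norm A; have := ler_norm (- a); rewrite normrN => na nA;
  have := normr_ge0 a; have := normr_ge0 A; move=> *; apply/andP; split; lra.
exists a%:M.
  split; [exact: tr_scalar_mx| |exact: le_mx_scalar].
  exact: le_mx_scalar.
rewrite mxtrace_mul_diag mulr_sumr; apply: eq_bigr => i _.
by rewrite mxE eqxx.
Qed.

Lemma pucci_diag_nonempty a A d : a <= A ->
  [set \tr (sigma *m diag_mx d) | sigma in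
    [set sigma | [/\ symmetric_mx sigma, le_mx a%:M sigma & le_mx sigma A%:M]]]
  !=set0.
Proof.
move=> aA; exists (\tr (a%:M *m diag_mx d)), a%:M => //.
by split; [exact: tr_scalar_mx|exact: le_mx_scalar|exact: le_mx_scalar].
Qed.

Lemma pucci_diag_le_nonneg a A d : a <= A -> (forall i, 0 <= d 0 i) ->
  pucci a A (diag_mx d) <= A * \sum_i d 0 i.
Proof.
move=> aA d0; apply: ge_sup; first exact: pucci_diag_nonempty.
move=> _ [sigma [_ aS SA] <-]; rewrite mxtrace_mul_diag mulr_sumr.
apply: ler_sum => i _; apply: ler_wpM2r => //.
by have /andP[] := diag_bounds a A sigma i aS SA.
Qed.

(** On nonpositive entries the smallest admissible weight, a, gives the largest trace. *)
Lemma pucci_diag_le_nonpos a A d : a <= A -> (forall i, d 0 i <= 0) ->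
  pucci a A (diag_mx d) <= a * \sum_i d 0 i.
Proof.
move=> aA d0; apply: ge_sup; first exact: pucci_diag_nonempty.
move=> _ [sigma [_ aS SA] <-]; rewrite mxtrace_mul_diag mulr_sumr.
apply: ler_sum => i _; apply: ler_wnM2r => //.
by have /andP[] := diag_bounds a A sigma i aS SA.
Qed.

End PucciDiagonal.

(** * The exponential barrier and the paraboloid as C^2 test functions *)

Section TestFunctions.
Context {R : realType} {n : nat}.
Local Notation V := 'rV[R]_n.+1.
Implicit Types (x v z : V) (f : V -> R) (Omega : set V).

(** The difference quotients of f along v are those of its restriction to a line, so one-variable
    calculus suffices. *)
Lemma is_derive_line x v f (df : R) :
  is_derive (0 : R) (1 : R) (fun h : R => f (h *: v + x)) df ->
  is_derive x v f df.
Proof.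
have E : (fun h : R => h^-1 *: ((f \o shift x) (h *: v) - f x)) =
  (fun h : R => h^-1 *: (((fun t : R => f (t *: v + x)) \o shift 0)
     (h *: (1:R)) - f ((0 : R) *: v + x))).
  by apply/funext => h /=; rewrite addr0 scale0r add0r /GRing.scale /= mulr1.
by case=> + D; split; [rewrite /derivable E|rewrite -D /derive E].
Qed.

Lemma is_derive_coord x v (i : 'I_n.+1) :
  is_derive x v (fun y : V => y 0 i) (v 0 i).
Proof.
apply: is_derive_line.
rewrite (_ : (fun h : R => _) = (v 0 i \*: @id R) + cst (x 0 i)); last first.
  by apply/funext => h; rewrite /= !mxE fctE /= /GRing.scale /= mulrC.
by apply: is_derive_eq; rewrite addr0 /GRing.scale /= mulr1.
Qed.

#[local] Existing Instance is_derive_coord.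

(** Varying in one coordinate only, this barrier has normal derivative k * phi * nu_0 and a rank-one
    Hessian with entry k^2 * phi: both are multiples of its value. *)
Definition exp_test (m k : R) : V -> R := fun y => m * expR (k * y 0 0).
Definition quad_test (c : R) z : V -> R :=
  fun y => c * dotv (y - z) (y - z).

Lemma is_derive_exp_test m k x v :
  is_derive x v (exp_test m k) (k * exp_test m k x * v 0 0).
Proof.
apply: is_derive_line.
rewrite /exp_test (_ : (fun h : R => _) =
   m \*: (expR \o ((k * v 0 0) \*: @id R + cst (k * x 0 0)))); last first.
  apply/funext => h; rewrite /= !mxE fctE /= /GRing.scale /=.
  by congr (_ * expR _); ring.
apply: is_derive_eq.
rewrite fctE /= /GRing.scale /= !mulr0 !add0r addr0 mulr1; ring.
Qed.

#[local] Existing Instance is_derive_exp_test.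

Lemma continuous_exp_test m k : continuous (exp_test m k).
Proof.
move=> x; apply: (@cvgMl_tmp _ _ (nbhs x)).
apply: (@continuous_cvg _ _ _ (nbhs x)); first exact: continuous_expR.
by apply: (@cvgMl_tmp _ _ (nbhs x)); exact: coord_continuous.
Qed.

Lemma continuous_quad_test c z : continuous (quad_test c z).
Proof.
move=> x; apply: (@cvgMl_tmp _ _ (nbhs x)).
have cf i : (fun y : V => (y - z) 0 i) @ x --> (x - z) 0 i.
  rewrite (_ : (fun y : V => _) = (fun y : V => y 0 i - z 0 i)).
    rewrite !mxE; apply: (@cvgB _ _ _ (nbhs x)); last exact: cvg_cst.
    exact: coord_continuous.
  by apply/funext => y; rewrite !mxE.
rewrite /dotv; apply: (@cvg_big _ _ _ _ _ add_continuous _ (nbhs x)) => i _.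
by apply: (@cvgM _ _ (nbhs x)); exact: cf.
Qed.

Lemma C2_closure_exp Omega m k :
  C2_closure Omega (exp_test m k)
    (fun y => (k * exp_test m k y) *: delta_mx 0 0)
    (fun y => diag_mx ((k ^+ 2 * exp_test m k y) *: delta_mx 0 0)).
Proof.
have cE c : continuous (fun y => c * exp_test m k y).
  move=> x; apply: (@cvgMl_tmp _ _ (nbhs x)).
  exact: continuous_exp_test.
split.
- exact/continuous_subspaceT/continuous_exp_test.
- apply/continuous_subspaceT => x.
  by apply: (@cvgZ _ _ _ (nbhs x)); [exact: cE|exact: cvg_cst].
- rewrite (_ : (fun y => _) =
    (fun y => (k ^+ 2 * exp_test m k y) *: diag_mx (delta_mx 0 0))); last first.
    by apply/funext => y; rewrite linearZ.
  apply/continuous_subspaceT => x.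
  by apply: (@cvgZ _ _ _ (nbhs x)); [exact: cE|exact: cvg_cst].
- by move=> x i _; apply: is_derive_eq; rewrite !mxE /= eq_sym.
- move=> x i j _.
  rewrite (_ : (fun y => _) =
     ((delta_mx 0 0 : V) 0 i * k) \*: exp_test m k); last first.
    by apply/funext => y; rewrite /= !mxE /GRing.scale /=; ring.
  apply: is_derive_eq; rewrite !mxE /GRing.scale /=.
  rewrite (eq_sym 0 j); have [<-|ij] := eqVneq i j.
    by case: (i == 0); rewrite /= ?mulr1n; ring.
  have [i0|_] := eqVneq i 0; last by rewrite /=; ring.
  by rewrite -i0 eq_sym (negbTE ij) /=; ring.
Qed.

Lemma C2_closure_quad Omega c z :
  C2_closure Omega (quad_test c z) (fun y => (c *+ 2) *: (y - z))
    (fun=> diag_mx (const_mx (c *+ 2))).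
Proof.
split.
- exact/continuous_subspaceT/continuous_quad_test.
- apply/continuous_subspaceT => x.
  apply: (@cvgZ _ _ _ (nbhs x)); first exact: cvg_cst.
  by apply: (@cvgB _ _ _ (nbhs x)); [exact: cvg_id|exact: cvg_cst].
- exact/continuous_subspaceT/cst_continuous.
- move=> x i _.
  rewrite (_ : quad_test c z = c \*: (\sum_(k < n.+1)
     ((fun y : V => y 0 k) - cst (z 0 k)) ^+ 2)); last first.
    apply/funext => y; rewrite /quad_test /dotv /= fct_sumE; congr (_ * _).
    by apply: eq_bigr => k _; rewrite !mxE.
  have dk k : is_derive x ('e_i) (((fun y : V => y 0 k) - cst (z 0 k)) ^+ 2)
      (2 * (x 0 k - z 0 k) * (k == i)%:R).
    by apply: is_derive_eq; rewrite !mxE /GRing.scale /= subr0 expr1 fctE.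
  apply: (is_derive_eq (is_deriveZ c (is_derive_sum dk))).
  rewrite (bigD1 i) //= big1 => [|k /negbTE ->]; last by rewrite mulr0.
  by rewrite !mxE eqxx /GRing.scale /=; ring.
- move=> x i j _.
  rewrite (_ : (fun y => _) =
     (c *+ 2) \*: ((fun y : V => y 0 i) - cst (z 0 i))); last first.
    by apply/funext => y; rewrite /= !mxE.
  apply: is_derive_eq; rewrite !mxE /GRing.scale /= subr0.
  by case: (i == j); rewrite /= ?mulr1n; ring.
Qed.

End TestFunctions.

(** * Normals, balls, compactness and touching barriers *)

Section Domain.
Context {R : realType} {n : nat}.
Local Notation V := 'rV[R]_n.+1.
Implicit Types (x y z : V) (v : V -> R) (Omega K : set V) (lambda alpha : R).

Lemma normalize_le1 x : normalize x 0 0 <= 1.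
Proof.
rewrite /normalize mxE; have [q0|] := leP (dotv x x) 0.
  (* For the zero vector the inverse of 0 is 0, so [normalize] returns 0. *)
  by rewrite ler0_sqrtr // invr0 mul0r.
move=> q0; rewrite mulrC ler_pdivrMr ?sqrtr_gt0 // mul1r.
apply: (le_trans (ler_norm _)); rewrite -sqrtr_sqr ler_sqrt ?(ltW q0) //.
rewrite /dotv (bigD1 0) //= -expr2 lerDl.
by apply: sumr_ge0 => i _; rewrite -expr2 sqr_ge0.
Qed.

(** Once a chart exists, [get] returns some normalized vector, and the bound holds whichever chart
    it comes from. *)
Lemma exterior_normal_le1 Omega x : C2_domain Omega -> boundary Omega x ->
  exterior_normal Omega x 0 0 <= 1.
Proof.
move=> [_ _ _ /(_ x)] + bx => /(_ bx) [i [b [g C]]].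
have : is_exterior_normal Omega x (exterior_normal Omega x).
  by apply: getPex; exists (normalize (grad (graph_fun i b g) x)), i, b, g.
by move=> [i' [b' [g' [_ ->]]]]; exact: normalize_le1.
Qed.

Lemma dotv_delta_l (c : R) y : dotv (c *: delta_mx 0 0) y = c * y 0 0.
Proof.
rewrite /dotv (bigD1 0) //= big1 => [|i /negbTE i0]; rewrite !mxE ?i0 ?eqxx.
  by rewrite mulr1 addr0.
by rewrite !mulr0 mul0r.
Qed.

(** The barrier of rate alpha / 2 strictly violates the Robin condition, whatever the direction of
    the normal. *)
Lemma half_normal_lt alpha (nu : R) : 0 < alpha -> nu <= 1 ->
  alpha / 2 * nu - alpha < 0.
Proof. by move=> a0 /(ler_wpM2l (ltW a0)); lra. Qed.

Lemma closure_cases Omega x : open Omega -> closure Omega x ->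
  Omega x \/ boundary Omega x.
Proof.
move=> oO cx; have [Ox|nOx] := pselect (Omega x); first by left.
by right; split => // /interior_subset.
Qed.

(** [ball] is a max-norm ball, hence contains the Euclidean ball of the same radius. *)
Lemma dotv_lt_ball z y (d : R) : 0 < d -> dotv (y - z) (y - z) < d ^+ 2 ->
  ball z d y.
Proof.
move=> d0 H; split=> // i j; rewrite ord1 /ball /= distrC.
rewrite -(ltr_pXn2r (n := 2)) ?nnegrE ?(ltW d0) // real_normK ?num_real //.
apply: le_lt_trans H; rewrite /dotv (bigD1 j) //= !mxE -expr2 lerDl.
by apply: sumr_ge0 => k _; rewrite -expr2 sqr_ge0.
Qed.

Lemma within_continuous_mul (D : set V) (f g : V -> R) :
  {within D, continuous f} -> continuous g ->
  {within D, continuous (fun x => f x * g x)}.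
Proof.
move=> cf /continuous_subspaceT cg x.
by apply: (@cvgM _ _ (nbhs x)); [exact: cf|exact: cg].
Qed.

Lemma within_continuous_sub (D : set V) (f g : V -> R) :
  {within D, continuous f} -> continuous g ->
  {within D, continuous (fun x => f x - g x)}.
Proof.
move=> cf /continuous_subspaceT cg x.
by apply: (@cvgB _ _ _ (nbhs x)); [exact: cf|exact: cg].
Qed.

Lemma bounded_closure_compact Omega : bounded_set Omega ->
  compact (closure Omega).
Proof.
move=> [M [Mreal HM]]; apply: bounded_closed_compact; last exact: closed_closure.
have cl : closed [set x : V | `|x| <= M + 1].
  apply: (@preimage_closed _ _ (fun x : V => `|x|) [set r | r <= M + 1]).
    by move=> x _; exact: norm_continuous.
  exact: closed_le.
have OM : closure Omega `<=` [set x : V | `|x| <= M + 1].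
  rewrite [X in _ `<=` X](iffLR (closure_id _) cl); apply: closureS => x Ox.
  by apply: HM => //; lra.
exists (M + 1); split; first exact: num_real.
by move=> r Mr x /OM /= xM; apply: le_trans xM (ltW Mr).
Qed.

Lemma exp_testK m (k : R) x : exp_test m k x * exp_test 1 (- k) x = m.
Proof.
by rewrite /exp_test mul1r -mulrA -expRD mulNr subrr expR0 mulr1.
Qed.

Lemma exp_test1_gt0 (k : R) x : 0 < exp_test 1 k x.
Proof. by rewrite /exp_test mul1r expR_gt0. Qed.

Lemma sum_delta (c : R) :
  \sum_(i < n.+1) (c *: (delta_mx 0 0 : V)) 0 i = c.
Proof.
rewrite (bigD1 0) //= big1 => [|i /negbTE i0]; rewrite !mxE ?i0 ?eqxx.
  by rewrite mulr1 addr0.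
by rewrite mulr0.
Qed.

(** The touching multiple m is the minimum of v(y) * expR (- k * y_0) over the compact closure,
    whatever the sign of v. *)
Lemma exp_touch_below Omega v (k : R) : Omega !=set0 -> bounded_set Omega ->
  {within closure Omega, continuous v} ->
  exists m x, [/\ closure Omega x, v x = exp_test m k x &
    forall y, closure Omega y -> exp_test m k y <= v y].
Proof.
move=> [x0 Ox0] Ob cv.
have [|x] := EVT_min_rV _ (bounded_closure_compact _ Ob)
  (within_continuous_mul _ _ _ cv (continuous_exp_test 1 (- k))).
  by exists x0; exact: subset_closure.
rewrite inE => cx xmin; set m := v x * _ in xmin.
exists m, x; split => // [|y cy].
  by apply: (mulIf (lt0r_neq0 (exp_test1_gt0 (- k) x))); rewrite exp_testK.
rewrite -(ler_pM2r (exp_test1_gt0 (- k) y)) exp_testK.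
by apply: xmin; rewrite inE.
Qed.

Lemma exp_touch_above Omega v (k : R) : Omega !=set0 -> bounded_set Omega ->
  {within closure Omega, continuous v} ->
  exists m x, [/\ closure Omega x, v x = exp_test m k x &
    forall y, closure Omega y -> v y <= exp_test m k y].
Proof.
move=> O0 Ob cv.
have [m [x [cx vx H]]] := exp_touch_below _ (- v) k O0 Ob
  (fun x => cvgN (cv x)).
have E y : exp_test (- m) k y = - exp_test m k y by rewrite /exp_test mulNr.
exists (- m), x; split=> // [|y cy]; rewrite E; first by rewrite -vx opprK.
by rewrite lerNr; exact: H.
Qed.

(** * The eigenvalue bound and the interior bound *)

Section Eigenvalue.
Variables (Omega : set V) (a A lambda alpha : R) (v : V -> R).
Hypotheses (C2O : C2_domain Omega) (Ob : bounded_set Omega).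
Hypotheses (aA : a <= A) (alpha_gt0 : 0 < alpha).
Hypothesis cv : {within closure Omega, continuous v}.

Lemma supersolution_eigenvalue_le : positive_on_closure Omega v ->
  viscosity_supersolution Omega a A lambda alpha v ->
  lambda <= - (a * (alpha / 2) ^+ 2).
Proof.
move=> v0 [_ vS]; have [oO _ O0 _] := C2O.
pose k := alpha / 2.
have [m [x [cx vx H]]] := exp_touch_below _ _ k O0 Ob cv.
have vx0 := v0 _ cx.
have [|Hint Hbd] := vS _ _ _ (C2_closure_exp Omega m k) x cx.
  by apply: (@filterE _ (nbhs x)) => y cy; rewrite vx subrr subr_ge0 H.
have P := pucci_diag_ge a A ((k ^+ 2 * exp_test m k x) *: delta_mx 0 0 : V) aA.
rewrite sum_delta -vx in P.
rewrite -vx in Hint Hbd.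
(* With [P] this gives (a * k^2 + lambda) * v x <= 0, and v x > 0 can be divided out. *)
suff : pucci a A (diag_mx ((k ^+ 2 * v x) *: delta_mx 0 0 : V))
    + lambda * v x <= 0.
  move=> Hp; rewrite -subr_le0 opprK -(pmulr_lle0 _ vx0); rewrite -/k; lra.
have [Ox|bx] := closure_cases _ _ oO cx; first exact: Hint.
(* At a boundary point the relaxed condition leaves two cases: the equation, as wanted, or the Robin
   inequality, excluded by v x * (k * nu - alpha) < 0. *)
have := Hbd bx; rewrite le_max oppr_ge0 => /orP[//|].
rewrite dotv_delta_l; have := exterior_normal_le1 _ _ C2O bx.
move: (exterior_normal _ _ _ _) => nu nu1 Hnu; exfalso.
have : v x * (alpha / 2 * nu - alpha) < 0.
   by rewrite pmulr_rlt0 ?half_normal_lt.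
by rewrite /k in Hnu; lra.
Qed.

Lemma subsolution_eigenvalue_le : negative_on_closure Omega v ->
  viscosity_subsolution Omega a A lambda alpha v ->
  lambda <= - (a * (alpha / 2) ^+ 2).
Proof.
move=> v0 [_ vS]; have [oO _ O0 _] := C2O.
pose k := alpha / 2.
have [m [x [cx vx H]]] := exp_touch_above _ _ k O0 Ob cv.
have vx0 := v0 _ cx.
have [|Hint Hbd] := vS _ _ _ (C2_closure_exp Omega m k) x cx.
  by apply: (@filterE _ (nbhs x)) => y cy; rewrite vx subrr subr_le0 H.
rewrite -vx in Hint Hbd.
have P : pucci a A (diag_mx ((k ^+ 2 * v x) *: delta_mx 0 0 : V)) <=
    a * (k ^+ 2 * v x).
  rewrite -[X in _ <= a * X]sum_delta.
  apply: pucci_diag_le_nonpos => // i; rewrite !mxE.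
  rewrite mulr_le0_ge0 ?ler0n // mulr_ge0_le0 ?sqr_ge0 //; exact: ltW.
suff : 0 <= pucci a A (diag_mx ((k ^+ 2 * v x) *: delta_mx 0 0 : V))
    + lambda * v x.
  move=> Hp; rewrite -subr_le0 opprK -(nmulr_lge0 _ vx0); rewrite -/k; lra.
have [Ox|bx] := closure_cases _ _ oO cx; first exact: Hint.
have := Hbd bx; rewrite ge_min oppr_le0 => /orP[//|].
rewrite dotv_delta_l; have := exterior_normal_le1 _ _ C2O bx.
move: (exterior_normal _ _ _ _) => nu nu1 Hnu; exfalso.
have : 0 < v x * (alpha / 2 * nu - alpha).
  by rewrite nmulr_rgt0 ?half_normal_lt.
by rewrite /k in Hnu; lra.
Qed.

Variables (z : V) (d : R).
Hypotheses (d_gt0 : 0 < d) (zd : ball z d `<=` Omega).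
Hypotheses (lambda_le0 : lambda <= 0).

Lemma subsolution_interior_bound :
  (forall x, closure Omega x -> v x <= 1) -> 0 < v z ->
  viscosity_subsolution Omega a A lambda alpha v ->
  - lambda * v z * d ^+ 2 <= 2 * A * n.+1%:R.
Proof.
(* With this c the paraboloid reaches 1, the upper bound of v, at distance d from z. *)
move=> v1 vz [_ vS]; pose c := d ^- 2.
have c0 : 0 < c by rewrite invr_gt0 exprn_gt0.
have Oz : Omega z by apply: zd; exact: ballxx.
have cz : closure Omega z by exact: subset_closure.
have [|x] := EVT_max_rV _ (bounded_closure_compact _ Ob)
  (within_continuous_sub _ _ _ cv (continuous_quad_test c z)).
  by exists z.
rewrite inE => cx xmax.
have qz : quad_test c z z = 0.
  by rewrite /quad_test subrr /dotv big1 ?mulr0 // => i _; rewrite mxE mul0r.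
have q0 : 0 <= dotv (x - z) (x - z).
  by apply: sumr_ge0 => i _; rewrite -expr2 sqr_ge0.
have vzx : v z + c * dotv (x - z) (x - z) <= v x.
  by have := xmax z; rewrite inE qz subr0 => /(_ cz); rewrite /quad_test; lra.
(* From c * |x - z|^2 <= v x - v z < 1 the maximum point is at distance less than d from z, so the
   interior inequality applies. *)
have Ox : Omega x.
  apply/zd/dotv_lt_ball => //; rewrite -[ltRHS]mul1r -ltr_pdivrMr ?exprn_gt0 //.
  by rewrite mulrC -/c; have := v1 _ cx; lra.
have [|Hint _] := vS _ _ _ (C2_closure_quad Omega c z) x cx.
  by apply: (@filterE _ (nbhs x)) => y cy; apply: xmax; rewrite inE.
have P : pucci a A (diag_mx (const_mx (c *+ 2) : V)) <= A * (n.+1%:R * (c *+ 2)).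
  apply: le_trans (pucci_diag_le_nonneg _ _ _ aA _) _.
    by move=> i; rewrite mxE mulrn_wge0 // ltW.
  by under eq_bigr do rewrite mxE; rewrite sumr_const card_ord mulr_natl.
have H : - lambda * v z <= 2 * A * n.+1%:R * c.
  have : - lambda * v z <= - lambda * v x.
    apply: ler_wpM2l; first by rewrite oppr_ge0.
    by have := mulr_ge0 (ltW c0) q0; lra.
  by move: P (Hint Ox); rewrite -mulr_natr; lra.
by rewrite -ler_pdivlMr ?exprn_gt0.
Qed.

(** The mirror argument with a concave paraboloid; its Hessian is negative, so a replaces A in the
    constant. *)
Lemma supersolution_interior_bound :
  (forall x, closure Omega x -> -1 <= v x) -> v z < 0 ->
  viscosity_supersolution Omega a A lambda alpha v ->
  - lambda * - v z * d ^+ 2 <= 2 * a * n.+1%:R.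
Proof.
move=> v1 vz [_ vS]; pose c := d ^- 2.
have c0 : 0 < c by rewrite invr_gt0 exprn_gt0.
have Oz : Omega z by apply: zd; exact: ballxx.
have cz : closure Omega z by exact: subset_closure.
have [|x] := EVT_min_rV _ (bounded_closure_compact _ Ob)
  (within_continuous_sub _ _ _ cv (continuous_quad_test (- c) z)).
  by exists z.
rewrite inE => cx xmin.
have qz : quad_test (- c) z z = 0.
  by rewrite /quad_test subrr /dotv big1 ?mulr0 // => i _; rewrite mxE mul0r.
have q0 : 0 <= dotv (x - z) (x - z).
  by apply: sumr_ge0 => i _; rewrite -expr2 sqr_ge0.
have vzx : v x <= v z - c * dotv (x - z) (x - z).
  by have := xmin z; rewrite inE qz subr0 => /(_ cz); rewrite /quad_test; lra.
have Ox : Omega x.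
  apply/zd/dotv_lt_ball => //; rewrite -[ltRHS]mul1r -ltr_pdivrMr ?exprn_gt0 //.
  by rewrite mulrC -/c; have := v1 _ cx; lra.
have [|Hint _] := vS _ _ _ (C2_closure_quad Omega (- c) z) x cx.
  by apply: (@filterE _ (nbhs x)) => y cy; apply: xmin; rewrite inE.
have P : a * (n.+1%:R * (- c *+ 2)) <=
    pucci a A (diag_mx (const_mx (- c *+ 2) : V)).
  apply: le_trans (pucci_diag_ge _ _ _ aA).
  by under eq_bigr do rewrite mxE; rewrite sumr_const card_ord mulr_natl.
have H : - lambda * - v z <= 2 * a * n.+1%:R * c.
  have : - lambda * - v z <= - lambda * - v x.
    apply: ler_wpM2l; first by rewrite oppr_ge0.
    by have := mulr_ge0 (ltW c0) q0; lra.
  by move: P (Hint Ox); rewrite -mulr_natr; lra.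
by rewrite -ler_pdivlMr ?exprn_gt0.
Qed.

End Eigenvalue.

(** * Sup norms and uniform decay on compact sets *)

Lemma sup_norm_ub Omega v : sup_norm Omega v != 0 ->
  forall x, Omega x -> `|v x| <= sup_norm Omega v.
Proof.
move=> s0 x Ox; apply: sup_upper_bound; last by exists x.
(* [sup] is 0 on sets without a supremum, so a nonzero value certifies boundedness. *)
by apply: contrapT => /sup_out /eqP; rewrite (negbTE s0).
Qed.

Lemma sup_norm_le K v (e : R) : 0 <= e -> (forall x, K x -> `|v x| <= e) ->
  `|sup_norm K v| <= e.
Proof.
move=> e0 He; have [->|/set0P[x Kx]] := eqVneq K set0.
  by rewrite /sup_norm image_set0 sup0 normr0.
have ub : ubound [set `|v x| | x in K] e by move=> _ [y Ky <-]; exact: He.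
have sle : sup_norm K v <= e by apply: ge_sup => //; exists `|v x|, x.
rewrite ger0_norm //; apply: (le_trans (normr_ge0 (v x))).
by apply: ub_le_sup; [exists e|exists x].
Qed.

Lemma sup_norm_cvg0 Omega K (u : R -> V -> R) (C : R) :
  open Omega -> compact K -> K `<=` Omega ->
  (forall alpha z d, 1 <= alpha -> 0 < d -> ball z d `<=` Omega ->
     alpha * `|u alpha z| * d ^+ 2 <= C) ->
  sup_norm K (u alpha) @[alpha --> +oo] --> (0 : R).
Proof.
move=> oO /compact_near_coveringP cK KO HC.
apply/cvgr0Pnorm_le => e e0.
suff : \forall alpha \near +oo, K `<=` [set x | `|u alpha x| <= e].
  by apply: filterS => alpha Ka; apply: sup_norm_le => //; exact: ltW.
apply: cK => x Kx.
have /nbhs_ballP [r /= r0 xr] := open_nbhs_nbhs (conj oO (KO _ Kx)).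
have r2 : 0 < r / 2 by rewrite divr_gt0.
(* Halving the radius of a ball around x gives one radius r / 2 valid for all y near x, hence one
   threshold on alpha; the near-covering form of compactness then makes it uniform on K. *)
near=> y alpha => /=.
have yO : ball y (r / 2) `<=` Omega.
  move=> w yw; apply: xr; rewrite [r]splitr; apply: ball_triangle yw.
  by near: y; exact: nbhsx_ballx.
have a1 : 1 <= alpha by near: alpha; apply: nbhs_pinfty_ge; exact: num_real.
have aC : C / (e * (r / 2) ^+ 2) < alpha.
  by near: alpha; apply: nbhs_pinfty_gt; exact: num_real.
rewrite leNgt; apply/negP => ue; move: aC; apply/negP; rewrite -leNgt.
rewrite ler_pdivlMr ?mulr_gt0 ?exprn_gt0 //.
apply: le_trans (HC _ _ _ a1 r2 yO); rewrite mulrA ler_wpM2r ?sqr_ge0 //.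
by rewrite ler_wpM2l ?(ltW ue) //; lra.
Unshelve. all: by end_near.
Qed.

End Domain.

Theorem proposition6p2 (R : realType) (n : nat) (Omega : set 'rV[R]_n.+1)
    (a A : R) (u_plus u_minus : R -> 'rV[R]_n.+1 -> R)
    (Omega_C2 : C2_domain Omega) (Omega_bounded : bounded_set Omega)
    (a_gt0 : 0 < a) (a_le_A : a <= A)
    (u_plus_solution : forall alpha, 0 < alpha ->
      [/\ viscosity_solution Omega a A (lambda_plus Omega a A alpha) alpha
            (u_plus alpha),
          positive_on_closure Omega (u_plus alpha) &
          sup_norm (closure Omega) (u_plus alpha) = 1])
    (u_minus_solution : forall alpha, 0 < alpha ->
      [/\ viscosity_solution Omega a A (lambda_minus Omega a A alpha) alpha
            (u_minus alpha),
          negative_on_closure Omega (u_minus alpha) &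
          sup_norm (closure Omega) (u_minus alpha) = 1])
    (K : set 'rV[R]_n.+1) (K_compact : compact K) (K_sub : K `<=` Omega) :
  sup_norm K (u_plus alpha) @[alpha --> +oo] --> (0 : R) /\
  sup_norm K (u_minus alpha) @[alpha --> +oo] --> (0 : R).
Proof.
have [oO _ _ _] := Omega_C2.
have unit_bound u : sup_norm (closure Omega) u = 1 ->
    forall x, closure Omega x -> - 1 <= u x <= 1.
  move=> u1 x cx; rewrite -ler_norml -u1; apply: sup_norm_ub => //.
  by rewrite u1 oner_neq0.
(* For [alpha >= 1], [alpha ^+ 2 >= alpha]: a linear rate is enough. *)
have rate (alpha lambda t C : R) : 1 <= alpha ->
    lambda <= - (a * (alpha / 2) ^+ 2) -> 0 <= t ->
    - lambda * t <= C -> alpha * t <= 4 / a * C.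
  move=> a1 le_lambda t0 leC.
  rewrite mulrAC ler_pdivlMr //.
  have : a * (alpha / 2) ^+ 2 * t <= - lambda * t.
    by apply: ler_wpM2r => //; lra.
  have : a * alpha * t <= a * alpha ^+ 2 * t.
    by rewrite ler_wpM2r // ler_wpM2l ?(ltW a_gt0) //; nra.
  lra.
split.
- apply: (sup_norm_cvg0 _ _ _ (4 / a * (2 * A * n.+1%:R)) oO K_compact K_sub).
  move=> alpha z d a1 d0 zd.
  have alpha_gt0 : 0 < alpha by lra.
  have [[cu sub super] u_gt0 u1] := u_plus_solution _ alpha_gt0.
  have le_lambda := supersolution_eigenvalue_le _ _ _ _ _ _
    Omega_C2 Omega_bounded a_le_A alpha_gt0 cu u_gt0 super.
  have uz : 0 < u_plus alpha z.
    by apply/u_gt0/subset_closure/zd; exact: ballxx.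
  (* [rate] is applied with t = u z * d^2, so the interior bound is exactly its last premise. *)
  rewrite gtr0_norm // -mulrA; apply: (rate _ _ _ _ a1 le_lambda).
    by rewrite mulr_ge0 ?sqr_ge0 // ltW.
  rewrite mulrA; apply: subsolution_interior_bound sub => //.
  + apply: le_trans le_lambda _.
    by rewrite oppr_le0 mulr_ge0 ?sqr_ge0 // ltW.
  + by move=> x /(unit_bound _ u1) /andP[].
- apply: (sup_norm_cvg0 _ _ _ (4 / a * (2 * a * n.+1%:R)) oO K_compact K_sub).
  move=> alpha z d a1 d0 zd.
  have alpha_gt0 : 0 < alpha by lra.
  have [[cu sub super] u_lt0 u1] := u_minus_solution _ alpha_gt0.
  have le_lambda := subsolution_eigenvalue_le _ _ _ _ _ _
    Omega_C2 Omega_bounded a_le_A alpha_gt0 cu u_lt0 sub.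
  have uz : u_minus alpha z < 0.
    by apply/u_lt0/subset_closure/zd; exact: ballxx.
  rewrite ltr0_norm // -mulrA; apply: (rate _ _ _ _ a1 le_lambda).
    by rewrite mulr_ge0 ?sqr_ge0 // oppr_ge0 ltW.
  rewrite mulrA; apply: supersolution_interior_bound super => //.
  + apply: le_trans le_lambda _.
    by rewrite oppr_le0 mulr_ge0 ?sqr_ge0 // ltW.
  + by move=> x /(unit_bound _ u1) /andP[].
Qed.
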